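(* Let $X,Y$ be arbitrary real-valued random variables on an atomless probability space (no integrability assumed). Let $(X^{\rm co},Y^{\rm co})$ be a comonotonic version of $(X,Y)$ and $(X^{\rm ct},Y^{\rm ct})$ a counter-monotonic version of $(X,Y)$. Then $$X^{\rm ct}+Y^{\rm ct}\le_{\rm cx} X+Y\le_{\rm cx} X^{\rm co}+Y^{\rm co}.$$
   Context: An expectation $\mathbb E[Z]$ is well-defined if $\mathbb E[\max\{Z,0\}]<\infty$ or $\mathbb E[\max\{-Z,0\}]<\infty$. We write $U\le_{\rm cx}V$ if $\mathbb E[u(U)]\le\mathbb E[u(V)]$ for all convex $u:\mathbb R\to\mathbb R$ such that both expectations are well-defined. A pair $(X,Y)$ is comonotonic if $X=f(Z)$ and $Y=g(Z)$ a.s. for some random variable $Z$ and increasing functions $f,g$; it is counter-monotonic if $(X,-Y)$ is comonotonic. A comonotonic (resp. counter-monotonic) version of $(X,Y)$ is a comonotonic (resp. counter-monotonic) pair $(X',Y')$ with $X'$ equal in distribution to $X$ and $Y'$ equal in distribution to $Y$. *)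

(* Defs.v *)
From HB Require Import structures.
From mathcomp Require Import all_boot all_order all_algebra.
From mathcomp Require Import all_classical all_reals all_analysis.
Set Implicit Arguments. Unset Strict Implicit. Unset Printing Implicit Defensive.
Import Order.TTheory GRing.Theory Num.Theory.
Local Open Scope classical_set_scope.
Local Open Scope ring_scope.

Section defs.
Context {d : measure_display} {T : measurableType d} {R : realType}.
Variable P : probability T R.

Definition atomless : Prop :=
  forall A : set T, measurable A -> (0 < P A)%E ->
    exists B : set T, [/\ measurable B, B `<=` A, (0 < P B)%E & (P B < P A)%E].

Definition rv (X : T -> R) : Prop := measurable_fun setT X.

Definition expectation_defined (Z : T -> R) : Prop :=
  (\int[P]_x (Num.max (Z x) 0)%:E < +oo)%E \/
  (\int[P]_x (Num.max (- Z x) 0)%:E < +oo)%E.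

Definition convex_fun (u : R -> R) : Prop :=
  forall (x y t : R), 0 <= t -> t <= 1 ->
    u (t * x + (1 - t) * y) <= t * u x + (1 - t) * u y.

Definition cx_le (U V : T -> R) : Prop :=
  forall u : R -> R, convex_fun u ->
    expectation_defined (u \o U) -> expectation_defined (u \o V) ->
    (\int[P]_x (u (U x))%:E <= \int[P]_x (u (V x))%:E)%E.

Definition eq_dist (X X' : T -> R) : Prop :=
  forall B : set R, measurable B -> P (X @^-1` B) = P (X' @^-1` B).

Definition comonotonic (X Y : T -> R) : Prop :=
  exists (Z : T -> R) (f g : R -> R),
    [/\ rv Z, {homo f : a b / a <= b}, {homo g : a b / a <= b} &
        {ae P, forall w, X w = f (Z w) /\ Y w = g (Z w)}].

Definition countermonotonic (X Y : T -> R) : Prop :=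
  comonotonic X (fun w => - Y w).

Definition comonotonic_version (X Y X' Y' : T -> R) : Prop :=
  [/\ rv X', rv Y', comonotonic X' Y', eq_dist X' X & eq_dist Y' Y].

Definition countermonotonic_version (X Y X' Y' : T -> R) : Prop :=
  [/\ rv X', rv Y', countermonotonic X' Y', eq_dist X' X & eq_dist Y' Y].
End defs.

(* Main.v *)
(** For pairs with the same marginals, P(X >= a, Y >= b) <= P(X' >= a, Y' >= b) for
    all a, b implies X + Y <=_cx X' + Y'.  The comonotonic version maximises these
    joint tails, since its upper level events are nested, and the countermonotonic
    one minimises them.

    Without integrability, each coordinate is truncated at level n.  As the
    truncation is odd, nondecreasing and 1-Lipschitz, the sum S_n of the truncated
    coordinates lies between 0 and S = X + Y, hence u^+(S_n) <= u^+(S) + C and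
    u^-(S_n) <= u^-(S) + C with C depending only on the convex function u.  Dominated
    convergence or Fatou's lemma then gives E u^+(S_n) -> E u^+(S) and
    E u^-(S_n) -> E u^-(S), finite or not.

    For bounded coordinates, rounding to a grid costs arbitrarily little because u
    is Lipschitz on bounded sets, and on the grid a double Abel summation writes
    E u(X + Y) as marginal terms plus a combination of the probabilities
    P(X >= a_i, Y >= a_j) whose coefficients are second differences of u. *)
Require Import Defs.
From HB Require Import structures.
From mathcomp Require Import all_boot all_order all_algebra.
From mathcomp Require Import all_classical all_reals all_analysis.
From mathcomp Require Import measurable_realfun ring lra.
Local Open Scope ring_scope.

Import Order.TTheory GRing.Theory Num.Theory.
Import numFieldNormedType.Exports.
Local Open Scope classical_set_scope.
Set Implicit Arguments. Unset Strict Implicit. Unset Printing Implicit Defensive.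

(** * Convex functions on the line: slopes, local Lipschitz bounds, continuity *)

Section convex_functions.
Context {R : realType} (u : R -> R).
Hypothesis cu : convex_fun u.

Lemma convex_fun_slope x y z : x < y -> y < z ->
  (u y - u x) / (y - x) <= (u z - u y) / (z - y).
Proof.
move=> xy yz.
have xy0 : 0 < y - x by rewrite subr_gt0.
have yz0 : 0 < z - y by rewrite subr_gt0.
have xz0 : 0 < z - x by rewrite subr_gt0 (lt_trans xy).
have tE : 1 - (z - y) / (z - x) = (y - x) / (z - x) by field; rewrite gt_eqF.
(* This weight writes [y] as a convex combination of [x] and [z]. *)
have := @cu x z ((z - y) / (z - x)).
rewrite tE => /(_ (divr_ge0 (ltW yz0) (ltW xz0))).
rewrite ler_pdivrMr// mul1r lerD2l lerN2 (ltW xy) => /(_ isT).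
have -> : (z - y) / (z - x) * x + (y - x) / (z - x) * z = y.
  by field; rewrite gt_eqF.
rewrite mulrAC [X in _ + X]mulrAC -mulrDl ler_pdivlMr// => h.
rewrite ler_pdivrMr// mulrAC ler_pdivlMr//.
by nra.
Qed.

(** Slopes of chords within [-M, M] are squeezed between the slope [a] over [-M-2, -M-1] and the
    slope [b] over [M+1, M+2]. The gaps of length 1 keep all the intervals compared
    nondegenerate. *)
Lemma convex_fun_lipschitz (M : R) : 0 < M ->
  exists2 L : R, 0 < L & forall x y, `|x| <= M -> `|y| <= M ->
    `|u x - u y| <= L * `|x - y|.
Proof.
move=> M0.
pose a := (u (- M - 1) - u (- M - 2)) / (- M - 1 - (- M - 2)).
pose b := (u (M + 2) - u (M + 1)) / (M + 2 - (M + 1)).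
exists (`|a| + `|b| + 1); first by rewrite ltr_wpDl// addr_ge0.
suff H x y : x < y -> `|x| <= M -> `|y| <= M ->
    `|u x - u y| <= (`|a| + `|b| + 1) * `|x - y|.
  move=> x y; have [xy|xy|->] := ltgtP x y; first exact: H.
    by move=> xM yM; rewrite distrC (distrC x); apply: H.
  by rewrite !subrr normr0 mulr0.
move=> xy; rewrite !(@ler_norml _ _ M) => /andP[x1 x2] /andP[y1 y2].
have a1 : a <= (u x - u (- M - 1)) / (x - (- M - 1)).
  by apply: convex_fun_slope; lra.
have a2 : (u x - u (- M - 1)) / (x - (- M - 1)) <= (u y - u x) / (y - x).
  by apply: convex_fun_slope; lra.
have b1 : (u (M + 1) - u y) / (M + 1 - y) <= b.
  by apply: convex_fun_slope; lra.
have b2 : (u y - u x) / (y - x) <= (u (M + 1) - u y) / (M + 1 - y).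
  by apply: convex_fun_slope; lra.
have yx0 : 0 < y - x by rewrite subr_gt0.
have -> : u x - u y = (u y - u x) / (y - x) * (x - y).
  by field; rewrite gt_eqF.
rewrite normrM ler_wpM2r// ler_norml.
have an := ler_norm (- a); have bn := ler_norm b; rewrite normrN in an.
have := normr_ge0 a; have := normr_ge0 b => *.
by apply/andP; split; lra.
Qed.

(** Continuity is what makes [u] Borel, so that [u] composed with a random variable is
    measurable. *)
Lemma convex_fun_continuous : continuous u.
Proof.
move=> x; have [] := @convex_fun_lipschitz (`|x| + 1).
  by rewrite ltr_wpDl.
move=> L L0 H; apply/cvgrPdist_le => e e0.
near=> y.
apply: le_trans (H x y _ _) _.
- by rewrite lerDl.
- near: y.
  have : \forall y \near x, `|x - y| < 1.
    exact: (@cvgr_dist_lt _ _ _ (nbhs x) _ id x (@cvg_id _ (nbhs x)) _ ltr01).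
  apply: filterS => y xy; rewrite -{1}(subrK x y) addrC.
  by rewrite (le_trans (ler_normD _ _))// lerD2l distrC ltW.
- rewrite mulrC -ler_pdivlMr//.
  near: y; apply: (@cvgr_dist_le _ _ _ (nbhs x) _ id x (@cvg_id _ (nbhs x))).
  exact: divr_gt0.
Unshelve. all: by end_near. Qed.

End convex_functions.

(** * Truncation of a real number to [-M, M] *)

Section truncation.
Context {R : realType}.

Definition between0 (s t : R) := (0 <= s <= t) || (t <= s <= 0).

Definition trunc (M x : R) := Num.max (- M) (Num.min M x).

Lemma trunc_cases M x : 0 <= M ->
  [\/ trunc M x = M /\ M <= x, trunc M x = x /\ - M <= x <= M |
      trunc M x = - M /\ x <= - M].
Proof.
rewrite /trunc => M0; have [Mx|xM] := leP M x.
  by rewrite max_r; [constructor 1|lra].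
have [Mx|{}xM] := leP (- M) x; first by constructor 2; rewrite (ltW xM).
by constructor 3; rewrite ltW.
Qed.

Lemma between0_trunc M x y : 0 <= M -> between0 (trunc M x + trunc M y) (x + y).
Proof.
rewrite /between0 => M0; apply/orP.
have [xy0|xy0] := lerP 0 (x + y); [left|right];
  by case: (trunc_cases x M0) => -[-> ?]; case: (trunc_cases y M0) => -[-> ?]; lra.
Qed.

Lemma truncE M x : `|x| <= M -> trunc M x = x.
Proof. by rewrite ler_norml => /andP[? ?]; rewrite /trunc min_r// max_r. Qed.

Lemma norm_trunc_le M x : 0 <= M -> `|trunc M x| <= M.
Proof.
by move=> M0; rewrite ler_norml; case: (trunc_cases x M0) => -[-> ?]; lra.
Qed.

Lemma trunc_cvg x : \forall n \near \oo, trunc n%:R x = x.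
Proof.
near=> n; apply: truncE.
near: n; exact: nbhs_infty_ger.
Unshelve. all: by end_near. Qed.

End truncation.

(** * Positive and negative parts of a convex function at points between 0 and t *)

Section between0_bounds.
Context {R : realType}.
Implicit Types u : R -> R.

(** For nonzero [t], the point [s] is the convex combination of [t] and 0 with weight [s / t] on
    [t]. *)
Lemma convex_fun_between0 u s t : convex_fun u -> between0 s t ->
  u s <= Num.max (u 0) (u t).
Proof.
move=> cu st.
have [t0|t0] := eqVneq t 0.
  have -> : s = 0 by move: st; rewrite /between0 t0; lra.
  by rewrite le_max lexx.
have l0 : 0 <= s / t.
  case/orP: st => /andP[s1 s2]; first by rewrite divr_ge0// (le_trans s1).
  by rewrite -mulrNN -invrN divr_ge0// oppr_ge0// (le_trans s1).
have l1 : s / t <= 1.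
  case/orP: st => /andP[s1 s2].
    by rewrite ler_pdivrMr ?mul1r// lt_neqAle eq_sym t0 (le_trans s1).
  by rewrite ler_ndivrMr ?mul1r// lt_neqAle t0 (le_trans s1).
have := cu t 0 (s / t) l0 l1; rewrite mulr0 addr0 divfK// => /le_trans; apply.
set l := s / t in l0 l1 *.
by have [] := leP (u 0) (u t) => ?; nra.
Qed.

Lemma convex_fun_between0_pos u : convex_fun u -> exists2 C, 0 <= C &
  forall s t, between0 s t -> Num.max (u s) 0 <= Num.max (u t) 0 + C.
Proof.
move=> cu; exists `|u 0| => // s t st.
have := ler_norm (u 0); have := normr_ge0 (u 0).
have := convex_fun_between0 cu st.
by case: (leP (u 0) (u t)) => ?; case: (leP (u s) 0) => ?; case: (leP (u t) 0) => ? *; lra.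
Qed.

(* On a half-line a convex function is either nonincreasing or bounded below. *)
Let half_line_bound u : convex_fun u -> exists2 C, 0 <= C &
  forall s t, 0 <= s <= t -> Num.max (- u s) 0 <= Num.max (- u t) 0 + C.
Proof.
move=> cu.
have [[a [b [a0 ab uab]]]|noinc] :=
    pselect (exists a b, [/\ 0 <= a, a < b & u a < u b]); last first.
  exists 0 => // s t /andP[s0 st]; rewrite addr0.
  have uts : u t <= u s.
    move: st; rewrite le_eqVlt => /predU1P[->//|st].
    by rewrite leNgt; apply/negP => ust; apply: noinc; exists s, t.
  by case: (leP (- u s) 0) => ?; case: (leP (- u t) 0) => ? *; lra.
have [L L0 uL] := convex_fun_lipschitz cu (le_lt_trans a0 ab).
exists (`|u b| + L * b + L * b).
  by rewrite !addr_ge0// mulr_ge0// ltW// (le_lt_trans a0).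
move=> s t /andP[s0 st].
suff : - u s <= `|u b| + L * b + L * b.
  have : 0 <= L * b by rewrite mulr_ge0// ltW// (le_lt_trans a0).
  by have := normr_ge0 (u b); case: (leP (- u s) 0) => ?; case: (leP (- u t) 0) => ? *; lra.
have nb := ler_norm (- u b); rewrite normrN in nb.
have Lb : 0 <= L * b by rewrite mulr_ge0// ltW// (le_lt_trans a0).
(* On [0, b] the Lipschitz bound keeps [u s] above [u b - L * b]. Beyond [b] the slope from [b] to
   [s] is at least the positive slope over [a, b], so [u s > u b]. *)
have [sb|bs] := leP s b.
  have b0 := le_lt_trans a0 ab.
  have := @uL s b; rewrite (ger0_norm s0) (gtr0_norm b0) sb lexx.
  move=> /(_ isT isT); rewrite distrC (distrC s) => /(le_trans (ler_norm _)).
  rewrite [ `|b - s| ]ger0_norm ?subr_ge0// => h.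
  have : 0 <= L * s by rewrite mulr_ge0// ltW.
  by move: h; rewrite mulrBr => *; lra.
have := convex_fun_slope cu ab bs.
have : 0 < (u b - u a) / (b - a) by rewrite divr_gt0// subr_gt0.
move=> /lt_le_trans/[apply]; rewrite pmulr_lgt0 ?invr_gt0 ?subr_gt0//.
by move=> *; lra.
Qed.

(** The half-line bound is applied to [u] for nonnegative points and to its reflection for
    nonpositive ones; the sum of the two constants serves both. *)
Lemma convex_fun_between0_neg u : convex_fun u -> exists2 C, 0 <= C &
  forall s t, between0 s t -> Num.max (- u s) 0 <= Num.max (- u t) 0 + C.
Proof.
move=> cu; have [C C0 H] := half_line_bound cu.
have cuN : convex_fun (u \o -%R).
  move=> x y t t0 t1 /=.
  have -> : - (t * x + (1 - t) * y) = t * - x + (1 - t) * - y by ring.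
  exact: cu.
have [D D0 K] := half_line_bound cuN.
exists (C + D); first exact: addr_ge0.
move=> s t /orP[/H|/andP[ts s0]].
  by move=> /le_trans; apply; rewrite addrA lerDl.
have := K (- s) (- t); rewrite oppr_ge0 s0 lerN2 ts => /(_ isT).
by rewrite /= !opprK => /le_trans; apply; rewrite lerD2l lerDr.
Qed.

End between0_bounds.

(** * Removing the truncation: convergence of expectations, finite or infinite *)

Section truncated_expectation.
Context {d : measure_display} {T : measurableType d} {R : realType}.
Variable P : probability T R.

Lemma cvg_integral_le_add_cst (g_ : nat -> T -> R) (g : T -> R) (C : R) :
  (forall n, measurable_fun setT (g_ n)) -> measurable_fun setT g ->
  (forall n x, 0 <= g_ n x) -> (forall x, 0 <= g x) ->
  (forall n x, g_ n x <= g x + C) ->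
  (forall x, \forall n \near \oo, g_ n x = g x) ->
  (\int[P]_x (g_ n x)%:E @[n --> \oo] --> \int[P]_x (g x)%:E)%E.
Proof.
move=> mg_ mg g_0 g0 gC geq.
have mEg_ n : measurable_fun setT (fun x => (g_ n x)%:E) by exact/measurable_EFinP.
have mEg : measurable_fun setT (fun x => (g x)%:E) by exact/measurable_EFinP.
have cvg_g x : ((g_ n x)%:E @[n --> \oo] --> (g x)%:E)%E.
  by apply: cvg_near_cst; apply: filterS (geq x) => n ->.
have [goo|] := ltP (\int[P]_x (g x)%:E)%E +oo%E.
  have ig : P.-integrable setT (EFin \o g).
    apply/integrableP; split => //; rewrite (le_lt_trans _ goo)//.
    apply: ge0_le_integral => //; first exact: measurableT_comp.
    by move=> x _ /=; rewrite ger0_norm.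
  have [] // := @dominated_convergence _ _ _ P setT measurableT
    (fun n => EFin \o g_ n) (EFin \o g) (fun x => (g x)%:E + C%:E)%E.
  - by apply/aeW => x _; exact: cvg_g.
  - by apply: integrableD => //; exact: finite_measure_integrable_cst.
  - by apply/aeW => x n _ /=; rewrite lee_fin ger0_norm.
(* When the integral of [g] is infinite there is no dominating function, but Fatou's lemma forces
   the limit inferior of the integrals to be infinite. *)
rewrite leye_eq => /eqP gy; rewrite gy.
have : limn_einf (fun n => \int[P]_x (g_ n x)%:E)%E = +oo%E.
  apply/eqP; rewrite -leye_eq -gy.
  have -> : (\int[P]_x (g x)%:E = \int[P]_x limn_einf (fun n => (g_ n x)%:E))%E.
    by apply: eq_integral => x _; rewrite (cvg_limn_einf_sup (cvg_g x)).
  by apply: (fatou P measurableT mEg_) => n x _; rewrite lee_fin.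
(* Two sign changes turn a limit inferior equal to [+oo] into a limit superior equal to [-oo], which
   yields convergence. *)
move=> ooE; set h := fun n => _.
have -> : h = (-%E \o (-%E \o h)) by apply/funext => n /=; rewrite oppeK.
apply: (cvgeN (x := -oo%E)); apply: limn_esup_le_cvg; last by move=> n; rewrite leNye.
by rewrite limn_esupN ooE.
Qed.

Lemma cvg_expectation_between0 (u : R -> R) (S_ : nat -> T -> R) (S : T -> R) :
  convex_fun u -> (forall n, rv (S_ n)) -> rv S ->
  (forall n x, between0 (S_ n x) (S x)) ->
  (forall x, \forall n \near \oo, S_ n x = S x) ->
  expectation_defined P (u \o S) ->
  (\int[P]_x (u (S_ n x))%:E @[n --> \oo] --> \int[P]_x (u (S x))%:E)%E.
Proof.
move=> cu mS_ mS bS eS dS.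
have mu : measurable_fun setT u.
  by apply: continuous_measurable_fun; exact: convex_fun_continuous.
have muS V : rv V -> rv (u \o V) by move=> ?; exact: measurableT_comp.
have intE V : (\int[P]_x (u (V x))%:E =
    \int[P]_x (Num.max (u (V x)) 0)%:E - \int[P]_x (Num.max (- u (V x)) 0)%:E)%E.
  by rewrite integralE (funerpos (u \o V)) (funerneg (u \o V)).
under eq_fun do rewrite intE.
rewrite intE; apply: cvgeB.
(* Well-definedness of the limit expectation makes one of the two parts finite, which excludes
   [+oo - +oo] when the limits are subtracted. *)
- have ge0 v : (0 <= \int[P]_x (Num.max (v x) 0)%:E)%E.
    by apply: integral_ge0 => x _; rewrite lee_fin le_max lexx orbT.
  have ge0E v := ge0_fin_numE (ge0 v).
  case: dS => dS; last by rewrite fin_num_adde_defl// fin_numN ge0E.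
  by rewrite fin_num_adde_defr// ge0E.
- have [C C0 H] := convex_fun_between0_pos cu.
  apply: (@cvg_integral_le_add_cst _ _ C) => [n||n x|x|n x|x].
  + by apply: measurable_maxr => //; exact: muS.
  + by apply: measurable_maxr => //; exact: muS.
  + by rewrite le_max lexx orbT.
  + by rewrite le_max lexx orbT.
  + exact: H.
  + by apply: filterS (eS x) => n ->.
- have [C C0 H] := convex_fun_between0_neg cu.
  have muNS V : rv V -> rv (fun x => - u (V x)) by move=> ?; exact/measurable_funN/muS.
  apply: (@cvg_integral_le_add_cst _ _ C) => [n||n x|x|n x|x].
  + by apply: measurable_maxr => //; exact: muNS.
  + by apply: measurable_maxr => //; exact: muNS.
  + by rewrite le_max lexx orbT.
  + by rewrite le_max lexx orbT.
  + exact: H.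
  + by apply: filterS (eS x) => n ->.
Qed.

End truncated_expectation.

(** * Double Abel summation *)

Section discrete_convexity.
Context {R : realType}.

Let telescope_nat (v : nat -> R) N p : (p <= N)%N ->
  \sum_(i < N) (i < p)%:R * (v i.+1 - v i) = v p - v 0%N.
Proof.
move=> pN; under eq_bigr do rewrite mulr_natl mulrb.
rewrite -(big_mkord (fun i => true) (fun i => if (i < p)%N then v i.+1 - v i else 0)).
rewrite (big_cat_nat (leq0n p) pN)/=.
rewrite (big_nat_cond _ _ p N) [X in _ + X]big1 => [|i /andP[/andP[pi _] _]]; last first.
  by rewrite ltnNge pi.
rewrite addr0 big_nat (eq_bigr (fun i => v i.+1 - v i)) => [|i /andP[_ ->]//].
by rewrite -big_nat telescope_sumr.
Qed.

(** Telescoping in each index separately gives v(p+q) = v(p) + v(q) - v(0) plus the second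
    differences at i+j for i < p and j < q. All sums run up to the fixed [N], so [p] and [q] enter
    only through the indicators of [i < p] and [j < q], which later become indicators of tail
    events. *)
Lemma abel_sum2 (v : nat -> R) N p q : (p <= N)%N -> (q <= N)%N ->
  v (p + q)%N = v 0%N +
    \sum_(i < N) (i < p)%:R * (v i.+1 - v i) +
    \sum_(i < N) (i < q)%:R * (v i.+1 - v i) +
    \sum_(ij : 'I_N * 'I_N) ((ij.1 < p) && (ij.2 < q))%N%:R *
      (v (ij.1 + ij.2).+2 - 2 * v (ij.1 + ij.2).+1 + v (ij.1 + ij.2)%N).
Proof.
move=> pN qN.
rewrite !telescope_nat//.
rewrite -(pair_bigA _ (fun i j : 'I_N => ((i < p) && (j < q))%N%:R *
  (v (i + j).+2 - 2 * v (i + j).+1 + v (i + j)%N)))/=.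
have E (i : 'I_N) : \sum_(j < N) ((i < p) && (j < q))%N%:R *
    (v (i + j).+2 - 2 * v (i + j).+1 + v (i + j)%N) =
    (i < p)%:R * ((v (i.+1 + q)%N - v i.+1) - (v (i + q)%N - v i)).
  (* For fixed [i], the second difference is the first difference in [j] of [w], so the inner sum
     telescopes. *)
  pose w j := v (i + j).+1 - v (i + j)%N.
  transitivity ((i < p)%:R * \sum_(j < N) (j < q)%:R * (w j.+1 - w j)).
    rewrite big_distrr/=; apply: eq_bigr => j _.
    by rewrite -mulnb natrM -mulrA /w addnS; congr (_ * (_ * _)); ring.
  by rewrite telescope_nat// /w addn0 addSn; congr (_ * _); ring.
rewrite (eq_bigr _ (fun i _ => E i)).
rewrite (eq_bigr (fun i : 'I_N => (i < p)%:R *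
  ((fun k => v (k + q)%N - v k) i.+1 - (fun k => v (k + q)%N - v k) i))).
  by rewrite (telescope_nat (fun k => v (k + q)%N - v k))// add0n; ring.
by [].
Qed.

End discrete_convexity.

(** * Rounding to a finite grid *)

Section grid.
Context {R : realType}.

(** For [h > 0] this counts the grid points a + h, ..., a + N h that are at most [x]. Since
    [Num.truncn] vanishes on negative numbers, points below [a] get index 0. *)
Definition grid_index (N : nat) (a h x : R) := minn N (Num.truncn ((x - a) / h)).

Lemma grid_index_le N a h x : (grid_index N a h x <= N)%N.
Proof. exact: geq_minl. Qed.

Lemma grid_index_gt N a h x i : 0 < h -> (i < N)%N ->
  (i < grid_index N a h x)%N = (a + i.+1%:R * h <= x).
Proof.
move=> h0 iN; rewrite /grid_index leq_min iN/= truncn_gt_nat.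
by rewrite ler_pdivlMr// lerBrDl.
Qed.

(** The grid cuts [-M, M] into [N] cells of width [h]. Outside this interval the index saturates at
    0 or [N], in agreement with the truncation. *)
Lemma grid_index_approx N M h x : 0 < h -> N%:R * h = 2 * M ->
  `|trunc M x - (- M + (grid_index N (- M) h x)%:R * h)| <= h.
Proof.
move=> h0 NhM.
have M0 : 0 <= M by have : 0 <= N%:R * h :> R; [rewrite mulr_ge0// ltW|lra].
have lb i : (i <= grid_index N (- M) h x)%N -> (0 < i)%N -> - M + i%:R * h <= x.
  case: i => // i ip _; rewrite -(@grid_index_gt N)//.
  exact: leq_trans ip (grid_index_le _ _ _ _).
have ub : (grid_index N (- M) h x < N)%N ->
    x < - M + (grid_index N (- M) h x)%:R * h + h.
  move=> pN; have := grid_index_gt (- M) x h0 pN.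
  rewrite ltnn => /esym/negbT; rewrite -ltNge -addrA -natr1 mulrDl mul1r.
  by rewrite addrA.
have := grid_index_le N (- M) h x; have := lb (grid_index N (- M) h x) (leqnn _).
move: ub; move: (grid_index _ _ _ _) => p ub lbp pN.
have p0 : 0 <= p%:R * h by rewrite mulr_ge0// ltW.
have pNh : p%:R * h <= N%:R * h by rewrite ler_pM2r// ler_nat.
(* The grid point bounds [x] from below unless the index is 0, and the next one bounds it from above
   unless the index is [N]; the two exceptions are the saturated ends. *)
have {}lbp : p%:R * h = 0 \/ - M + p%:R * h <= x.
  by case: (posnP p) => [->|/lbp]; [left; rewrite mul0r|right].
have {}ub : p%:R * h = 2 * M \/ x < - M + p%:R * h + h.
  by move: pN; rewrite leq_eqVlt => /predU1P[->|/ub]; [left|right].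
rewrite NhM in pNh; move: (p%:R * h) p0 pNh lbp ub => Q *.
rewrite ler_norml.
by case: (trunc_cases x M0) => -[-> ?]; lra.
Qed.

End grid.

(** * From joint tail probabilities to the convex order of sums *)

Section supermodular.
Context {d : measure_display} {T : measurableType d} {R : realType}.
Variable P : probability T R.

Lemma integral_cst_probability (c : R) : (\int[P]_x c%:E = c%:E)%E.
Proof.
rewrite integral_cst// -[RHS]mule1; congr (_ * _)%E; exact: probability_setT.
Qed.

Lemma integral_sum_indic (I : Type) (r : seq I) (A : I -> set T) (c : I -> R) :
  (forall i, measurable (A i)) ->
  P.-integrable setT (fun x => (\sum_(i <- r) \1_(A i) x * c i)%:E) /\
  (\int[P]_x (\sum_(i <- r) \1_(A i) x * c i)%:E = \sum_(i <- r) (c i)%:E * P (A i))%E.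
Proof.
move=> mA.
have iA i : P.-integrable setT (fun x => (c i)%:E * (\1_(A i) x)%:E)%E.
  by apply: integrableZl => //; exact: integrable_indic.
have -> : (fun x => (\sum_(i <- r) \1_(A i) x * c i)%:E) =
    (fun x => \sum_(i <- r) (c i)%:E * (\1_(A i) x)%:E)%E.
  by apply/funext => x; rewrite -sumEFin; apply: eq_bigr => i _; rewrite mulrC.
split; first exact: integrable_sum.
rewrite integral_sum//; apply: eq_bigr => i _.
by rewrite integralZl ?integral_indic ?setIT//; exact: integrable_indic.
Qed.

Definition tail (X : T -> R) (a : R) : set T := X @^-1` [set x | a <= x].

Lemma measurable_tail (X : T -> R) a : rv X -> measurable (tail X a).
Proof.
move=> mX; rewrite /tail -[X in measurable X]setTI; apply: mX => //.
by rewrite -set_itvcy.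
Qed.

(** This is [abel_sum2] integrated term by term. The dependence between [X] and [Y] enters only
    through the last sum. *)
Lemma expectation_grid (v : nat -> R) N a h (X Y : T -> R) : 0 < h -> rv X -> rv Y ->
  let p x := grid_index N a h (X x) in let q x := grid_index N a h (Y x) in
  let t i := a + i.+1%:R * h in
  P.-integrable setT (fun x => (v (p x + q x)%N)%:E) /\
  (\int[P]_x (v (p x + q x)%N)%:E = (v 0%N)%:E +
    \sum_(i < N) (v i.+1 - v i)%:E * P (tail X (t i)) +
    \sum_(i < N) (v i.+1 - v i)%:E * P (tail Y (t i)) +
    \sum_(ij : 'I_N * 'I_N)
      (v (ij.1 + ij.2).+2 - 2 * v (ij.1 + ij.2).+1 + v (ij.1 + ij.2)%N)%:E *
      P (tail X (t ij.1) `&` tail Y (t ij.2)))%E.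
Proof.
move=> h0 mX mY p q t.
have indE (Z : T -> R) (i : 'I_N) x :
    (i < grid_index N a h (Z x))%N%:R = \1_(tail Z (t i)) x :> R.
  by rewrite indicE grid_index_gt//; congr (_%:R); rewrite mem_setE.
have -> : (fun x => (v (p x + q x)%N)%:E) = (fun x => ((v 0%N)%:E +
    (\sum_(i < N) \1_(tail X (t i)) x * (v i.+1 - v i))%:E +
    (\sum_(i < N) \1_(tail Y (t i)) x * (v i.+1 - v i))%:E +
    (\sum_(ij : 'I_N * 'I_N) \1_(tail X (t ij.1) `&`
        tail Y (t ij.2)) x *
      (v (ij.1 + ij.2).+2 - 2 * v (ij.1 + ij.2).+1 + v (ij.1 + ij.2)%N))%:E)%E).
  apply/funext => x; rewrite (@abel_sum2 _ v N) ?grid_index_le// !EFinD.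
  congr (_ + _ + _ + _)%E; congr (_%:E); apply: eq_bigr => i _.
  - by rewrite indE.
  - by rewrite indE.
  - by rewrite indicI/= -!indE -mulnb natrM.
have mXt i := measurable_tail (t i) mX.
have mYt i := measurable_tail (t i) mY.
have [i1 e1] := integral_sum_indic (index_enum 'I_N) (fun i => v i.+1 - v i)
  (fun i : 'I_N => mXt i).
have [i2 e2] := integral_sum_indic (index_enum 'I_N) (fun i => v i.+1 - v i)
  (fun i : 'I_N => mYt i).
have [i3 e3] := integral_sum_indic (index_enum ('I_N * 'I_N)%type)
  (fun ij => v (ij.1 + ij.2).+2 - 2 * v (ij.1 + ij.2).+1 + v (ij.1 + ij.2)%N)
  (fun ij : 'I_N * 'I_N => measurableI _ _ (mXt ij.1) (mYt ij.2)).
have i0 : P.-integrable setT (fun _ : T => (v 0%N)%:E).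
  exact: finite_measure_integrable_cst.
have i01 := integrableD measurableT i0 i1.
have i012 := integrableD measurableT i01 i2.
split; first exact: integrableD.
by rewrite !integralD//= e1 e2 e3 integral_cst_probability.
Qed.

(** Equal marginals make the single sums agree, and discrete convexity of [v] makes the weights of
    the joint tails nonnegative. *)
Lemma le_expectation_grid (v : nat -> R) N a h (X Y X' Y' : T -> R) : 0 < h ->
  rv X -> rv Y -> rv X' -> rv Y' -> eq_dist P X X' -> eq_dist P Y Y' ->
  (forall a b, P (tail X a `&` tail Y b) <=
     P (tail X' a `&` tail Y' b))%E ->
  (forall k, 2 * v k.+1 <= v k.+2 + v k) ->
  (\int[P]_x (v (grid_index N a h (X x) + grid_index N a h (Y x))%N)%:E <=
   \int[P]_x (v (grid_index N a h (X' x) + grid_index N a h (Y' x))%N)%:E)%E.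
Proof.
move=> h0 mX mY mX' mY' XX' YY' J cv.
rewrite (expectation_grid _ _ _ h0 mX mY).2 (expectation_grid _ _ _ h0 mX' mY').2.
have mle (b : R) : measurable [set x | b <= x] by rewrite -set_itvcy.
under eq_bigr do rewrite XX'//.
under [X in (_ + _ + X + _)%E]eq_bigr do rewrite YY'//.
apply: leeD2l; apply: lee_sum => ij _; apply: lee_wpmul2l; last exact: J.
by rewrite lee_fin; have := cv (ij.1 + ij.2)%N; lra.
Qed.

Lemma integral_dist_le (F G : T -> R) e : measurable_fun setT F ->
  P.-integrable setT (EFin \o G) -> (forall x, `|F x - G x| <= e) ->
  (\int[P]_x (F x)%:E <= \int[P]_x (G x)%:E + e%:E /\
   \int[P]_x (G x)%:E <= \int[P]_x (F x)%:E + e%:E)%E.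
Proof.
move=> mF iG FG.
have ie : P.-integrable setT (fun=> e%:E) by exact: finite_measure_integrable_cst.
have iF : P.-integrable setT (EFin \o F).
  apply: (@le_integrable _ _ _ P setT measurableT _ (fun x => `|(G x)%:E| + e%:E)%E).
  - exact/measurable_EFinP.
  - move=> x _ /=; rewrite lee_fin; apply: le_trans (ler_norm _).
    rewrite -lerBlDl; apply: le_trans (FG x).
    by apply: le_trans (ler_norm _) (ler_dist_dist _ _).
  - by apply: integrableD => //; exact: integrable_abse.
have inte (H : T -> R) : P.-integrable setT (EFin \o H) ->
    (\int[P]_x (H x)%:E + e%:E = \int[P]_x ((H x)%:E + e%:E))%E.
  move=> iH; rewrite integralD//=.
  by rewrite integral_cst_probability.
split; rewrite inte//; apply: le_integral => //; [|rewrite /comp| |].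
all: try exact: integrableD.
all: move=> x _ /=; rewrite lee_fin; have := FG x; rewrite ler_norml.
all: by lra.
Qed.

Lemma measurable_trunc M (X : T -> R) : rv X -> rv (fun x => trunc M (X x)).
Proof.
by move=> mX; apply: measurable_maxr => //; exact: measurable_minr.
Qed.

Lemma le_expectation_trunc (u : R -> R) M (X Y X' Y' : T -> R) : convex_fun u -> 0 < M ->
  rv X -> rv Y -> rv X' -> rv Y' -> eq_dist P X X' -> eq_dist P Y Y' ->
  (forall a b, P (tail X a `&` tail Y b) <=
     P (tail X' a `&` tail Y' b))%E ->
  (\int[P]_x (u (trunc M (X x) + trunc M (Y x)))%:E <=
   \int[P]_x (u (trunc M (X' x) + trunc M (Y' x)))%:E)%E.
Proof.
move=> cu M0 mX mY mX' mY' XX' YY' J.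
(* The radius is [2 * M] because [u] is evaluated at sums of two points of [-M, M]. *)
have [L L0 uL] := convex_fun_lipschitz cu (mulr_gt0 (ltr0n R 2) M0).
apply/lee_addgt0Pr => e e0.
(* Each coordinate is rounded with error at most [h], so [u] changes by at most L (2 h) = 4 L M / N.
   This [N] makes that at most [e / 2], and rounding is paid for twice, once for each pair. *)
pose N := (Num.truncn (8 * L * M / e)).+1; pose h := 2 * M / N%:R.
have N0 : 0 < N%:R :> R by rewrite ltr0n.
have h0 : 0 < h by rewrite divr_gt0// mulr_gt0.
have NhM : N%:R * h = 2 * M by rewrite mulrC divfK// gt_eqF.
have Lh : L * (h + h) <= e / 2.
  have : 8 * L * M / e < N%:R by exact: truncnS_gt.
  rewrite ltr_pdivrMr// => LMe.
  have -> : L * (h + h) = 4 * L * M / N%:R by rewrite /h; field; rewrite gt_eqF.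
  by rewrite ler_pdivrMr//; lra.
(* The sum of the grid points with indices i and j depends only on k = i + j; midpoint convexity of
   [u] gives nonnegative second differences of [v]. *)
pose v k := u (- M + - M + k%:R * h).
have cv k : 2 * v k.+1 <= v k.+2 + v k.
  have := cu (- M + - M + k.+2%:R * h) (- M + - M + k%:R * h) (1 / 2).
  have -> : 1 / 2 * (- M + - M + k.+2%:R * h) +
      (1 - 1 / 2) * (- M + - M + k%:R * h) = - M + - M + k.+1%:R * h.
    by rewrite -!natr1; field.
  rewrite -/(v k.+2) -/(v k.+1) -/(v k) => /(_ ltac:(lra) ltac:(lra)).
  by lra.
pose g (Z W : T -> R) x := v (grid_index N (- M) h (Z x) + grid_index N (- M) h (W x))%N.
have approx Z W : rv Z -> rv W -> let F x := u (trunc M (Z x) + trunc M (W x)) in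
    (\int[P]_x (F x)%:E <= \int[P]_x (g Z W x)%:E + (e / 2)%:E /\
     \int[P]_x (g Z W x)%:E <= \int[P]_x (F x)%:E + (e / 2)%:E)%E.
  move=> mZ mW F; apply: integral_dist_le.
  - apply: measurableT_comp.
      by apply: continuous_measurable_fun; exact: convex_fun_continuous.
    by apply: measurable_funD; exact: measurable_trunc.
  - exact: (expectation_grid v N (- M) h0 mZ mW).1.
  - move=> x; rewrite /F /g /v.
    have gM z : `|- M + (grid_index N (- M) h z)%:R * h| <= M.
      have : (grid_index N (- M) h z)%:R * h <= N%:R * h.
        by rewrite ler_pM2r// ler_nat grid_index_le.
      have : 0 <= (grid_index N (- M) h z)%:R * h by rewrite mulr_ge0// ltW.
      by rewrite NhM ler_norml; lra.
    rewrite natrD mulrDl addrACA.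
    apply: le_trans Lh; apply: le_trans (uL _ _ _ _) _.
    + rewrite mulrDl mul1r; apply: le_trans (ler_normD _ _) _.
      by rewrite lerD// norm_trunc_le// ltW.
    + by rewrite mulrDl mul1r; apply: le_trans (ler_normD _ _) _; rewrite lerD.
    + rewrite ler_pM2l// opprD addrACA; apply: le_trans (ler_normD _ _) _.
      by rewrite lerD// grid_index_approx.
apply: le_trans (approx _ _ mX mY).1 _.
have -> : e%:E = ((e / 2)%:E + (e / 2)%:E)%E by rewrite -EFinD -splitr.
rewrite addeA leeD2r//; apply: le_trans (approx _ _ mX' mY').2.
exact: le_expectation_grid.
Qed.

Lemma cx_le_of_tails (X Y X' Y' : T -> R) :
  rv X -> rv Y -> rv X' -> rv Y' -> eq_dist P X X' -> eq_dist P Y Y' ->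
  (forall a b, P (tail X a `&` tail Y b) <= P (tail X' a `&` tail Y' b))%E ->
  cx_le P (fun w => X w + Y w) (fun w => X' w + Y' w).
Proof.
move=> mX mY mX' mY' XX' YY' J u cu dS dS'.
pose S_ (Z W : T -> R) n x := trunc n%:R (Z x) + trunc n%:R (W x).
have cvgS Z W : rv Z -> rv W -> expectation_defined P (u \o (fun x => Z x + W x)) ->
    (\int[P]_x (u (S_ Z W n x))%:E @[n --> \oo] --> \int[P]_x (u (Z x + W x))%:E)%E.
  move=> mZ mW dZW; apply: cvg_expectation_between0 => //.
  - by move=> n; apply: measurable_funD; exact: measurable_trunc.
  - exact: measurable_funD.
  - by move=> n x; exact: between0_trunc.
  - by move=> x; apply: filterS2 (trunc_cvg (Z x)) (trunc_cvg (W x)) => n; rewrite /S_ => -> ->.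
apply: (lee_cvg_to (cvgS _ _ mX mY dS) (cvgS _ _ mX' mY' dS')).
near=> n; apply: le_expectation_trunc => //.
by rewrite ltr0n; near: n; exact: nbhs_infty_gt.
Unshelve. all: by end_near. Qed.

End supermodular.

(** * Extremal joint tails of comonotonic and counter-monotonic pairs *)

Section comonotonic_tails.
Context {d : measure_display} {T : measurableType d} {R : realType}.
Variable P : probability T R.
Implicit Types X Y : T -> R.

(** General upper sets cover both closed half-lines and the open ones that arise from complements of
    tails in the counter-monotonic case. *)
Let up_closed (U : set R) := forall x y, x <= y -> U x -> U y.

Lemma measurable_preimage X U : rv X -> measurable U -> measurable (X @^-1` U).
Proof. by move=> mX mU; rewrite -[X in measurable X]setTI; exact: mX. Qed.

Lemma le_measure_ae (A B N : set T) : measurable A -> measurable B -> measurable N ->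
  P N = 0%E -> A `<=` B `|` N -> (P A <= P B)%E.
Proof.
move=> mA mB mN N0 ABN.
have mBN := measurableU _ _ mB mN.
apply: (@le_trans _ _ (P (B `|` N))); first by apply: le_measure; rewrite ?inE.
apply: le_trans (measureU2 _ _ _) _ => //; rewrite -[leRHS]adde0 leeD2l//.
by rewrite le_eqVlt; apply/orP; left; exact/eqP.
Qed.

(* Up to a null set, two upper level events of a comonotonic pair are nested. *)
Lemma comonotonic_up_closed X Y X' Y' U V : rv X -> rv Y -> rv X' -> rv Y' ->
  comonotonic P X' Y' -> eq_dist P X' X -> eq_dist P Y' Y ->
  up_closed U -> up_closed V -> measurable U -> measurable V ->
  (P (X @^-1` U `&` Y @^-1` V) <= P (X' @^-1` U `&` Y' @^-1` V))%E.
Proof.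
move=> mX mY mX' mY' [Z [f [g [_ fi gi [N [mN N0 fgN]]]]]] XX' YY' upU upV mU mV.
have fgZ w : X' w = f (Z w) /\ Y' w = g (Z w) \/ N w.
  have [h|h] := pselect (X' w = f (Z w) /\ Y' w = g (Z w)); first by left.
  by right; exact: fgN.
have mXU := measurable_preimage mX mU; have mYV := measurable_preimage mY mV.
have mX'U := measurable_preimage mX' mU; have mY'V := measurable_preimage mY' mV.
(* Both preimages are upper sets of the line, hence one contains the other. Up to the null set [N],
   the joint event of the comonotonic pair is then the smaller of its two marginal events, whose
   probability bounds the joint probability for any pair with these marginals. *)
have [fg|gf] : f @^-1` U `<=` g @^-1` V \/ g @^-1` V `<=` f @^-1` U.
  have [|/existsNP[z /not_implyP[Uz nVz]]] := pselect (f @^-1` U `<=` g @^-1` V).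
    by left.
  right=> w Vw; have [zw|wz] := leP z w; first exact: upU (fi _ _ zw) Uz.
  by exfalso; apply: nVz; exact: upV (gi _ _ (ltW wz)) Vw.
- apply: (@le_trans _ _ (P (X @^-1` U))).
    by apply: le_measure; rewrite ?inE//; exact: measurableI.
  rewrite -XX'//; apply: (le_measure_ae _ _ mN) => //; first exact: measurableI.
  move=> w; case: (fgZ w) => [[Xw Yw] Uw|]; last by right.
  by left; split => //=; rewrite Yw; apply: fg; rewrite /= -Xw.
- apply: (@le_trans _ _ (P (Y @^-1` V))).
    by apply: le_measure; rewrite ?inE//; exact: measurableI.
  rewrite -YY'//; apply: (le_measure_ae _ _ mN) => //; first exact: measurableI.
  move=> w; case: (fgZ w) => [[Xw Yw] Vw|]; last by right.
  by left; split => //=; rewrite Xw; apply: gf; rewrite /= -Yw.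
Qed.

Lemma eq_distN X X' : eq_dist P X' X -> eq_dist P (\- X') (\- X).
Proof.
move=> XX' B mB; apply: (XX' (-%R @^-1` B)).
by rewrite -[X in measurable X]setTI; exact: oppr_measurable.
Qed.

(** The pair [X'], [\- Y'] is comonotonic, so it maximises P(X >= a, -Y > -b) = P(X >= a) - P(X >=
    a, Y >= b). As P(X >= a) is fixed by the marginal, the joint tail is minimised. *)
Lemma countermonotonic_tails X Y X' Y' : rv X -> rv Y -> rv X' -> rv Y' ->
  countermonotonic P X' Y' -> eq_dist P X' X -> eq_dist P Y' Y -> forall a b,
  (P (tail X' a `&` tail Y' b) <= P (tail X a `&` tail Y b))%E.
Proof.
move=> mX mY mX' mY' ct XX' YY' a b.
have mN (Z : T -> R) : rv Z -> rv (\- Z) by exact: measurable_funN.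
have := @comonotonic_up_closed X (\- Y) X' (\- Y') [set x | a <= x] [set y | - b < y]
  mX (mN _ mY) mX' (mN _ mY') ct XX' (eq_distN YY').
have upa : up_closed [set x | a <= x] by move=> x y /= xy ax; exact: le_trans xy.
have upb : up_closed [set x | - b < x] by move=> x y /= xy ax; exact: lt_le_trans xy.
have ma : measurable [set x | a <= x] by rewrite -set_itvcy.
have mb : measurable [set x | - b < x] by rewrite -set_itvoy.
move=> /(_ upa upb ma mb).
have E (Z : T -> R) : (\- Z) @^-1` [set y | - b < y] = ~` tail Z b.
  by apply/seteqP; split => w /=; rewrite /tail/= ltrN2 ltNge => /negP.
have fin A : measurable A -> P A \is a fin_num by exact: fin_num_measure.
have mtX := measurable_tail a mX; have mtY := measurable_tail b mY.
have mtX' := measurable_tail a mX'; have mtY' := measurable_tail b mY'.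
have PX : P (tail X' a) = P (tail X a) by exact: XX'.
have PD A B : measurable A -> measurable B -> (P (A `\` B) = P A - P (A `&` B))%E.
  by move=> mA mB; apply: measureD => //; rewrite ltey_eq fin.
rewrite !E -!setDE !PD// PX.
by rewrite leeD2lE ?fin// leeN2.
Qed.

End comonotonic_tails.

Theorem theorem3 (d : measure_display) (T : measurableType d) (R : realType)
  (P : probability T R) (X Y Xco Yco Xct Yct : T -> R) :
  atomless P -> rv X -> rv Y ->
  comonotonic_version P X Y Xco Yco ->
  countermonotonic_version P X Y Xct Yct ->
  cx_le P (fun w => Xct w + Yct w) (fun w => X w + Y w) /\
  cx_le P (fun w => X w + Y w) (fun w => Xco w + Yco w).
Proof.
move=> _ mX mY [mXco mYco co XcoX YcoY] [mXct mYct ct XctX YctY]; split.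
  apply: cx_le_of_tails => //; exact: countermonotonic_tails.
apply: cx_le_of_tails => // [B mB|B mB|a b].
- by rewrite XcoX.
- by rewrite YcoY.
- apply: (comonotonic_up_closed mX mY mXco mYco co XcoX YcoY).
  + by move=> x y /= xy ax; exact: le_trans xy.
  + by move=> x y /= xy ax; exact: le_trans xy.
  + by rewrite -set_itvcy.
  + by rewrite -set_itvcy.
Qed.
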